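(* Let $R$ be a domain and let $M$ be a cl.Hilbert $R$-module. Then the following hold: (1) If $T(M)$ is the torsion submodule of $M$, then $T(M)$ is a cl.Hilbert $R$-module. (2) If $M$ is torsion-free and $N$ is a pure submodule of $M$, then $N$ is a cl.Hilbert $R$-module.
   Context: All rings are commutative with identity $1\neq 0$ and all modules are unital. A proper submodule $P$ of an $R$-module $M$ is classical prime if for all $a,b\in R$ and $m\in M$, $abm\in P$ implies $am\in P$ or $bm\in P$. An $R$-module $M$ is a cl.Hilbert module (classical Hilbert module) if every classical prime submodule of $M$ is an intersection of maximal submodules of $M$. A submodule $N$ of an $R$-module $M$ is called pure if $IN=N\cap IM$ for every ideal $I$ of $R$. *)

(* Defs.v *)
From HB Require Import structures.
From mathcomp Require Import all_boot all_order all_algebra.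
From mathcomp Require Import boolp classical_sets.
Set Implicit Arguments.
Unset Strict Implicit.
Unset Printing Implicit Defensive.
Import GRing.Theory.
Local Open Scope ring_scope.
Local Open Scope classical_set_scope.

(* A submodule of M is an element of the library type [submodClosed M]: a
   boolean predicate on M closed under the module operations.  With [asbool],
   these predicates account for all submodules of M. *)

Definition submodule (R : comNzRingType) (M : lmodType R)
  (N : submodClosed M) : Type := {x : M | x \in N}.

HB.instance Definition _ (R : comNzRingType) (M : lmodType R)
  (N : submodClosed M) := SubChoice.on (submodule N).
HB.instance Definition _ (R : comNzRingType) (M : lmodType R)
  (N : submodClosed M) := [SubChoice_isSubLmodule of submodule N by <:].

Section ClassicalHilbert.
Variables (R : comNzRingType) (M : lmodType R).
Implicit Types P Q N : submodClosed M.

Definition proper_submodule P : Prop := exists m : M, m \notin P.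

Definition maximal_submodule Q : Prop :=
  proper_submodule Q /\
  forall N, {subset Q <= N} -> proper_submodule N -> N =i Q.

Definition classical_prime P : Prop :=
  proper_submodule P /\
  forall (a b : R) (m : M),
    (a * b) *: m \in P -> a *: m \in P \/ b *: m \in P.

Definition intersection_of_maximal P : Prop :=
  exists F : set (submodClosed M),
    F `<=` maximal_submodule /\ [set` P] = \bigcap_(Q in F) [set` Q].

Definition cl_Hilbert : Prop :=
  forall P, classical_prime P -> intersection_of_maximal P.

(* An ideal of R is a submodule of the regular module R^o; in particular the
   unit ideal is allowed. *)
Definition ideal_mul (I : submodClosed R^o) (N : set M) : set M :=
  [set m | exists (n : nat) (a : 'I_n -> R) (x : 'I_n -> M),
     [/\ forall i, (a i : R^o) \in I, forall i, N (x i)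
       & m = \sum_(i < n) a i *: x i]].

Definition pure_submodule N : Prop :=
  forall I : submodClosed R^o,
    ideal_mul I [set` N] = [set` N] `&` ideal_mul I setT.

End ClassicalHilbert.

Arguments cl_Hilbert {R} M.

Section Torsion.
Variables (R : idomainType) (M : lmodType R).

Definition torsion : {pred M} :=
  fun m => `[< exists2 r : R, r != 0 & r *: m = 0 >].

Fact torsion_submod_closed : submod_closed torsion.
Proof.
split=> [|a u v /asboolP[r r0 ru] /asboolP[s s0 sv]]; apply/asboolP.
  by exists 1; rewrite ?oner_neq0 // scaler0.
exists (r * s); first by rewrite mulf_neq0.
by rewrite scalerDr -[X in _ + X]scalerA sv scaler0 addr0 scalerA -mulrA
  mulrC -scalerA ru scaler0.
Qed.

HB.instance Definition _ :=
  GRing.isSubmodClosed.Build R M torsion torsion_submod_closed.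

Definition torsion_free : Prop := torsion =i pred1 (0 : M).

End Torsion.

Arguments torsion {R} M.
Arguments torsion_free {R} M.

(* Main.v *)
(* If every [m] with [r *: m \in N] for some [r != 0] already lies in [N], then
   a classical prime submodule [P] of [N] is classical prime in [M] as well:
   [(a * b) *: m \in P] with [a * b != 0] forces [m \in N].  Hence [P] is an
   intersection of maximal submodules [Q] of [M], and each [Q :&: N] is either
   [N] or maximal in [N], because [N / (Q :&: N)] embeds in the simple module
   [M / Q].  Torsion submodules, and pure submodules of torsion-free modules,
   satisfy this hypothesis on [N]. *)
Require Import Defs.
From HB Require Import structures.
From mathcomp Require Import all_boot all_order all_algebra.
From mathcomp Require Import boolp classical_sets.
Set Implicit Arguments.
Unset Strict Implicit.
Unset Printing Implicit Defensive.
Import GRing.Theory.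
Local Open Scope ring_scope.
Local Open Scope classical_set_scope.

Section SubmoduleConstructions.
Variables (R : comNzRingType) (M : lmodType R).

Definition sumsub (P Q : submodClosed M) : {pred M} :=
  fun m => `[< exists x y, [/\ x \in P, y \in Q & m = x + y] >].

Fact sumsub_submod_closed (P Q : submodClosed M) :
  submod_closed (sumsub P Q).
Proof.
split=> [|a _ _ /asboolP[x [y [xP yQ ->]]] /asboolP[x' [y' [x'P y'Q ->]]]];
  apply/asboolP.
  by exists 0, 0; rewrite !rpred0 addr0.
exists (a *: x + x'), (a *: y + y').
by rewrite !rpredD ?rpredZ // scalerDr addrACA.
Qed.

HB.instance Definition _ (P Q : submodClosed M) :=
  GRing.isSubmodClosed.Build R M (sumsub P Q) (sumsub_submod_closed P Q).

(** For [M := R^o] this is the principal ideal of [v], the ideal to which purity gets applied. *)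
Definition span1 (v : M) : {pred M} := fun m => `[< exists a, m = a *: v >].

Fact span1_submod_closed (v : M) : submod_closed (span1 v).
Proof.
split=> [|a _ _ /asboolP[b ->] /asboolP[c ->]]; apply/asboolP.
  by exists 0; rewrite scale0r.
by exists (a * b + c); rewrite scalerDl scalerA.
Qed.

HB.instance Definition _ (v : M) :=
  GRing.isSubmodClosed.Build R M (span1 v) (span1_submod_closed v).

Variable N : submodClosed M.

Definition imsub (L : submodClosed (submodule N)) : {pred M} :=
  fun m => `[< exists2 x : submodule N, x \in L & m = val x >].

Fact imsub_submod_closed (L : submodClosed (submodule N)) :
  submod_closed (imsub L).
Proof.
split=> [|a _ _ /asboolP[x xL ->] /asboolP[y yL ->]]; apply/asboolP.
  by exists 0; rewrite ?rpred0 ?raddf0.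
by exists (a *: x + y); rewrite ?rpredD ?rpredZ // linearP.
Qed.

HB.instance Definition _ (L : submodClosed (submodule N)) :=
  GRing.isSubmodClosed.Build R M (imsub L) (imsub_submod_closed L).

Lemma val_imsub (L : submodClosed (submodule N)) (x : submodule N) :
  (val x \in imsub L) = (x \in L).
Proof.
apply/idP/idP=> [/asboolP[y yL /val_inj ->] //|xL].
by apply/asboolP; exists x.
Qed.

Definition presub (Q : submodClosed M) : {pred submodule N} :=
  fun x => val x \in Q.

Fact presub_submod_closed (Q : submodClosed M) : submod_closed (presub Q).
Proof.
split=> [|a x y xQ yQ]; rewrite unfold_in /presub.
  by rewrite raddf0 rpred0.
by rewrite linearP rpredD ?rpredZ.
Qed.

HB.instance Definition _ (Q : submodClosed M) :=
  GRing.isSubmodClosed.Build R (submodule N) (presub Q)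
    (presub_submod_closed Q).

(** Modular law: if [L] contains the trace of [Q] on [N] and some [y] outside [Q], then [Q + L = M].
    Any [z] in [N] is then [q + l], where [q = z - l] lies in both [Q] and [N], hence in [L]; so [L]
    is not proper. *)
Lemma presub_maximal (Q : submodClosed M) :
  maximal_submodule Q -> proper_submodule (presub Q) ->
  maximal_submodule (presub Q).
Proof.
move=> [_ Qmax] Qpr; split=> // L QL [z zL] y.
apply/idP/idP=> [yL|]; last exact: QL.
case: (boolP (val y \in Q)) => // yQ; case/negP: zL.
(* An [m] outside the sum would make it proper, hence equal to [Q] by maximality, although it
   contains [val y]. *)
have sumT m : m \in sumsub Q (imsub L).
  apply: contraT => mS; case/negP: yQ; rewrite -(Qmax (sumsub Q (imsub L))).
  - by apply/asboolP; exists 0, (val y); rewrite rpred0 val_imsub add0r.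
  - move=> x xQ; apply/asboolP; exists x, 0.
    by rewrite rpred0 addr0.
  - by exists m.
have /asboolP[q [_ [qQ /asboolP[l lL ->] zE]]] := sumT (val z).
have zlL : z - l \in L.
  by apply: QL; rewrite unfold_in /presub raddfB /= zE addrK.
by rewrite -(subrK l z) rpredD.
Qed.

End SubmoduleConstructions.

Lemma cl_Hilbert_saturated (R : idomainType) (M : lmodType R)
    (N : submodClosed M) :
  (forall (r : R) (m : M), r != 0 -> r *: m \in N -> m \in N) ->
  cl_Hilbert M -> cl_Hilbert (submodule N).
Proof.
move=> Nsat hM P [[z zP] Pprime].
have primeP : classical_prime (imsub P).
  split=> [|a b m abmP]; first by exists (val z); rewrite val_imsub.
  (* Saturation says nothing when [a * b = 0]; there [a] or [b] vanishes, as [R] is a domain. *)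
  have [/eqP|ab0] := eqVneq (a * b) 0.
    by rewrite mulf_eq0 => /orP[]/eqP ->; [left|right];
      rewrite scale0r rpred0.
  have mN : m \in N.
    case/asboolP: abmP => x _ xE; apply: (Nsat _ _ ab0).
    by rewrite xE; exact: valP x.
  pose x : submodule N := Sub m mN.
  have valZ c : c *: m = val (c *: x) by rewrite linearZ.
  by move: abmP; rewrite !valZ !val_imsub; exact: Pprime.
have [F [Fmax PF]] := hM _ primeP.
have memP x : (x \in P) <-> (forall Q, F Q -> val x \in Q).
  rewrite -val_imsub.
  by have -> : (val x \in imsub P : Prop) = (\bigcap_(Q in F) [set` Q]) (val x)
    by rewrite -PF.
(* Taking all maximal submodules above [P], instead of the traces of the members of [F], avoids
   sorting out the traces equal to [N]. *)
exists [set L | maximal_submodule L /\ {subset P <= L}].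
split=> [L []//|]; apply/seteqP; split=> [x xP L [_]|x xF]; first exact.
(* If [x] is outside [Q], then [x] itself shows that the trace of [Q] is proper, so this trace
   belongs to the family and must contain [x]. *)
apply/memP => Q FQ; apply: contraT => xQ; case/negP: (xQ).
apply: (xF (presub Q)); split=> [|y /memP/(_ Q FQ) //].
by apply: presub_maximal; [exact: Fmax | exists x].
Qed.

Lemma torsion_saturated (R : idomainType) (M : lmodType R) (r : R) (m : M) :
  r != 0 -> r *: m \in torsion M -> m \in torsion M.
Proof.
move=> r0 /asboolP[s s0 srm]; apply/asboolP; exists (s * r).
  by rewrite mulf_neq0.
by rewrite -scalerA.
Qed.

(** Purity at the ideal [(r)] puts [r *: m] in [(r)N], so [r *: m = r *: y] with [y] in [N];
    torsion-freeness cancels [r]. *)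
Lemma pure_saturated (R : idomainType) (M : lmodType R)
    (N : submodClosed M) (r : R) (m : M) :
  torsion_free M -> pure_submodule N -> r != 0 -> r *: m \in N -> m \in N.
Proof.
move=> tf pureN r0 rmN.
have : ([set` N] `&` ideal_mul (span1 (r : R^o)) setT) (r *: m).
  split=> //; exists 1%N, (fun=> r), (fun=> m); split=> //.
    by move=> _; apply/asboolP; exists 1; rewrite scale1r.
  by rewrite big_ord1.
rewrite -pureN => -[n [a [x [aI xN rmE]]]].
have /fin_all_exists[c cE] i : exists c : R, a i = c * r.
  by have /asboolP[c] := aI i; exists c.
pose y := \sum_i c i *: x i.
have yN : y \in N by apply: rpred_sum => i _; apply/rpredZ/xN.
have : m - y \in torsion M.
  apply/asboolP; exists r => //; rewrite scalerBr rmE scaler_sumr.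
  by apply/eqP; rewrite subr_eq0; apply/eqP/eq_bigr => i _;
    rewrite cE scalerA mulrC.
by rewrite tf inE subr_eq0 => /eqP ->.
Qed.

Theorem corollary2p14 (R : idomainType) (M : lmodType R) (hM : cl_Hilbert M) :
  cl_Hilbert (submodule (torsion M)) /\
  (torsion_free M ->
   forall N : submodClosed M, pure_submodule N -> cl_Hilbert (submodule N)).
Proof.
split=> [|tf N pureN]; apply: cl_Hilbert_saturated hM => r m.
  exact: torsion_saturated.
exact: pure_saturated.
Qed.
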